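(* If a graph $X$ admits proper Laplacian fractional revival between vertices $a$ and $b$, then $a$ and $b$ are Laplacian strongly cospectral.
   Context: Let $L=D-A$ be the Laplacian of $X$ with spectral decomposition $L=\sum_r\mu_rF_r$ ($F_r$ the orthogonal projection onto the $\mu_r$-eigenspace), and $U(t)=\exp(itL)$. $X$ admits Laplacian fractional revival from $a$ to $b\ne a$ at time $\tau$ if $U(\tau)e_a=\alpha e_a+\beta e_b$ for some complex $\alpha,\beta$; it is proper if $\beta\neq0$. Vertices $a,b$ are Laplacian strongly cospectral if $F_re_a=\pm F_re_b$ for every $r$. *)

(* Defs.v *)
From HB Require Import structures.
From mathcomp Require Import all_boot all_order all_algebra.
From mathcomp Require Import spectral complex.
From mathcomp Require Import all_classical all_reals all_analysis.

Set Implicit Arguments.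
Unset Strict Implicit.
Unset Printing Implicit Defensive.

Import Order.TTheory GRing.Theory Num.Theory.
Import numFieldNormedType.Exports.
Local Open Scope ring_scope.
Local Open Scope complex_scope.

(* The topology of R[i] induced by its norm, as for every abstract
   numFieldType; needed for limits of complex matrices. *)
HB.instance Definition _ (R : rcfType) :=
  NormedModule.copy R[i] (R[i]^o : normedModType R[i]).

Record simple_graph (n : nat) := SimpleGraph {
  adj :> rel 'I_n;
  adj_sym : symmetric adj;
  adj_irrefl : irreflexive adj
}.

Section Laplacian.
Variables (R : realType) (n : nat) (X : simple_graph n).

Definition adjacency_mx : 'M[R[i]]_n := \matrix_(i, j) (X i j)%:R.

Definition degree (i : 'I_n) : nat := #|[set j | X i j]|.

Definition degree_mx : 'M[R[i]]_n := diag_mx (\row_i (degree i)%:R).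

Definition laplacian : 'M[R[i]]_n := degree_mx - adjacency_mx.

End Laplacian.

Section MatrixFunctions.
Variables (R : realType) (n : nat).

(* [lim] is total: the value is meaningful because the exponential series of
   a matrix always converges in the normed space 'M[R[i]]_n. *)
Definition expmx (A : 'M[R[i]]_n) : 'M[R[i]]_n :=
  limn (series (fun k : nat => k`!%:R^-1 *: A ^+ k)).

(* [eigenspace] and [proj_ortho] act on row vectors from the right; the two
   transpositions make [eigenproj A mu *m v] the orthogonal projection (for the
   Hermitian inner product) of the column v onto {v | A *m v = mu *: v}. *)
Definition eigenproj (A : 'M[R[i]]_n) (mu : R[i]) : 'M[R[i]]_n :=
  (proj_ortho (eigenspace A^T mu))^T.

Definition vertex_vec (a : 'I_n) : 'cV[R[i]]_n := delta_mx a 0.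

End MatrixFunctions.

Section Revival.
Variables (R : realType) (n : nat) (X : simple_graph n).

Definition transition_mx (t : R) : 'M[R[i]]_n :=
  expmx (('i%C * t%:C) *: laplacian R X).

Definition laplacian_fractional_revival (a b : 'I_n) (tau : R)
    (alpha beta : R[i]) : Prop :=
  b <> a /\
  transition_mx tau *m vertex_vec R a =
    alpha *: vertex_vec R a + beta *: vertex_vec R b.

Definition proper_laplacian_fractional_revival (a b : 'I_n) : Prop :=
  exists (tau : R) (alpha beta : R[i]),
    laplacian_fractional_revival a b tau alpha beta /\ beta <> 0.

Definition laplacian_strongly_cospectral (a b : 'I_n) : Prop :=
  forall mu : R[i], eigenvalue (laplacian R X) mu ->
    let F := eigenproj (laplacian R X) mu in
    F *m vertex_vec R a = F *m vertex_vec R b \/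
    F *m vertex_vec R a = - (F *m vertex_vec R b).

End Revival.

(* Main.v *)
Require Import Defs.
From mathcomp Require Import all_boot all_order all_algebra.
From mathcomp Require Import spectral complex.
From mathcomp Require Import all_classical all_reals all_analysis.

(* Let U = U(tau), which is unitary, symmetric and fixes the all-ones vector
   because L is Hermitian, symmetric and kills that vector. Writing
   U e_a = alpha e_a + beta e_b, unitarity and symmetry put U e_b in the span of
   e_a and e_b with e_a-coefficient beta; comparing coordinate sums, which U
   preserves, its e_b-coefficient is alpha. Since F U = lambda F for an
   eigenprojection F, the vectors u = F e_a and v = F e_b satisfy
   (lambda - alpha) u = beta v and (lambda - alpha) v = beta u, so that
   (lambda - alpha)^2 = beta^2 unless u = v = 0. *)

Set Implicit Arguments.
Unset Strict Implicit.
Unset Printing Implicit Defensive.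

Import Order.TTheory GRing.Theory Num.Theory.
Import numFieldNormedType.Exports.
Local Open Scope ring_scope.
Local Open Scope complex_scope.
Local Open Scope classical_set_scope.
Local Open Scope sesquilinear_scope.

(** * Euler's formula and the exponential of a diagonalised matrix *)

Section Convergence.
Variable R : realType.

Lemma cvg_real_complex (u : nat -> R) (l : R) :
  u @ \oo --> l -> (fun k => (u k)%:C) @ \oo --> (l%:C : R[i]).
Proof.
move=> /cvgrPdist_lt ul; apply/cvgrPdist_lt => e.
(* The radius [e] is complex; being positive in the order of [R[i]], it has zero imaginary part and
   so is a real radius. *)
rewrite ltcE /= => /andP[/eqP ime e0].
have -> : e = (complex.Re e)%:C by case: e ime {e0} => ? ? /= ->.
apply: filterS (ul _ e0) => k.
by rewrite -rmorphB /= normc_def /= expr0n addr0 sqrtr_sqr ltcR.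
Qed.

Lemma expi_coeffE (x : R) (k : nat) :
  k`!%:R^-1 * ('i%C * x%:C) ^+ k =
  (cos_coeff x k)%:C + 'i%C * (sin_coeff x k)%:C :> R[i].
Proof.
rewrite exprMn -rmorphXn /= mulrC -[in LHS](rmorph_nat (real_complex R)).
(* Parity decides whether the power of i is real or imaginary. The exponents match [cos_coeff] and
   [sin_coeff]; for odd [k] both halves coincide. *)
have -> : 'i%C ^+ k = (((~~ odd k)%:R * (-1) ^+ k./2 : R)%:C
  + 'i%C * ((odd k)%:R * (-1) ^+ k.-1./2 : R)%:C) :> R[i].
  rewrite -[in LHS](odd_double_half k) exprD -mul2n exprM sqr_i.
  case: (boolP (odd k)) => ok; rewrite ?mul0r ?mul1r ?mulr0 ?addr0 ?add0r ?expr1.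
    have -> : k.-1./2 = k./2.
      by case: k ok => //= k /negPf ok; rewrite uphalf_half ok.
    by rewrite rmorphXn rmorphN rmorph1.
  by rewrite rmorphXn rmorphN rmorph1.
rewrite mulrDl mulrDl -fmorphV -!mulrA -!rmorphM /= /cos_coeff /sin_coeff /=.
by rewrite -!exprnP !mulrA.
Qed.

Lemma cvg_expi (x : R) :
  series (fun k => k`!%:R^-1 * ('i%C * x%:C) ^+ k) @ \oo -->
  (cos x +i* sin x : R[i]).
Proof.
have -> : series (fun k => k`!%:R^-1 * ('i%C * x%:C) ^+ k) = fun n =>
    (series (cos_coeff x) n)%:C + 'i%C * (series (sin_coeff x) n)%:C :> R[i].
  apply/funext => n; rewrite /series /= !rmorph_sum mulr_sumr -big_split /=.
  by apply: eq_bigr => k _; exact: expi_coeffE.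
rewrite (complexE (cos x +i* sin x)) /=.
apply: cvgD; last apply: cvgMr; apply: cvg_real_complex.
  by rewrite unlock; exact: is_cvg_series_cos_coeff.
by rewrite unlock; exact: is_cvg_series_sin_coeff.
Qed.

Lemma cvg_mx m n (u : nat -> 'M[R[i]]_(m, n)) (M : 'M[R[i]]_(m, n)) :
  (forall i j, (fun k => u k i j) @ \oo --> M i j) -> u @ \oo --> M.
Proof.
move=> uM A [P MP PA].
have : \forall k \near \oo, forall i j, P i j (u k i j).
  by apply: filter_forall => i; apply: filter_forall => j; exact: uM (MP i j).
by apply: filterS => k; exact: PA.
Qed.

(** Conjugation commutes with powers, so each entry of a partial sum is a finite linear combination
    of the scalar partial sums, and the limit can be taken entrywise. *)
Lemma expmx_conj_diag n (P : 'M[R[i]]_n) (d f : 'rV[R[i]]_n) :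
  P \in unitmx ->
  (forall j, series (fun k => k`!%:R^-1 * d 0 j ^+ k) @ \oo --> f 0 j) ->
  expmx (invmx P *m diag_mx d *m P) = invmx P *m diag_mx f *m P.
Proof.
move=> Pu df.
have powE k : (invmx P *m diag_mx d *m P) ^+ k =
    invmx P *m diag_mx (\row_j d 0 j ^+ k) *m P.
  elim: k => [|k IHk].
    rewrite (_ : diag_mx _ = 1%:M) ?mulmx1 ?mulVmx //.
    by apply/matrixP => i j; rewrite !mxE.
  rewrite exprS IHk -mulmxE !mulmxA mulmxK // -[_ *m _ *m diag_mx _]mulmxA.
  rewrite mulmx_diag; congr (_ *m diag_mx _ *m _).
  by apply/rowP => j; rewrite !mxE exprS.
apply: cvg_lim; first exact: norm_hausdorff.
apply: cvg_mx => i j; rewrite (_ : (fun k => _) = fun N =>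
  \sum_l invmx P i l * series (fun k => k`!%:R^-1 * d 0 l ^+ k) N * P l j).
  have -> : (invmx P *m diag_mx f *m P) i j =
            \sum_l invmx P i l * f 0 l * P l j.
    by rewrite mxE; apply: eq_bigr => l _; rewrite mul_mx_diag mxE.
  apply: cvg_big => [|l _]; first exact: add_continuous.
  by apply: cvgMl; apply: cvgMr; exact: df.
apply/funext => N; rewrite /series /= summxE.
transitivity (\sum_(0 <= k < N) \sum_l
    invmx P i l * (k`!%:R^-1 * d 0 l ^+ k) * P l j).
  apply: eq_bigr => k _; rewrite powE !mxE mulr_sumr.
  apply: eq_bigr => l _; rewrite mul_mx_diag !mxE !mulrA.
  by rewrite [_ * invmx P i l]mulrC.
rewrite exchange_big /=; apply: eq_bigr => l _.
by rewrite mulr_sumr mulr_suml.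
Qed.

End Convergence.

(** * Intertwining relations and eigenprojections *)

Section SpectralCalculus.
Variables (C : numClosedFieldType) (n : nat).

(** Entrywise, [M i j] is zero or the two diagonal values agree. This carries relations with a
    matrix over to functions of that matrix. *)
Lemma diag_mx_intertwine m (M : 'M[C]_(m, n)) (d f : 'rV[C]_n)
    (d' f' : 'rV[C]_m) :
  (forall i j, d' 0 i = d 0 j -> f' 0 i = f 0 j) ->
  diag_mx d' *m M = M *m diag_mx d -> diag_mx f' *m M = M *m diag_mx f.
Proof.
move=> df /matrixP dM; apply/matrixP => i j.
move: (dM i j); rewrite !mul_diag_mx !mul_mx_diag !mxE => dMij.
have [->|Mij] := eqVneq (M i j) 0; first by rewrite mulr0 mul0r.
rewrite mulrC; congr (_ * _); apply: df.
by apply: (mulIf Mij); rewrite dMij mulrC.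
Qed.

(** For the row projection P, PA = mu P is immediate. For the other side, a Hermitian A preserves
    the orthogonal complement of the eigenspace, so (1 - P)AP = 0 and AP = PAP = mu P. *)
Lemma proj_ortho_eigenspaceC (A : 'M[C]_n) (mu : C) : A \is hermsymmx ->
  A *m proj_ortho (eigenspace A mu) = mu *: proj_ortho (eigenspace A mu).
Proof.
move=> Aherm; set E := eigenspace A mu; set P := proj_ortho E.
have PE : (P <= E)%MS by rewrite proj_orthoE.
have PA : P *m A = mu *: P by exact/eigenspaceP.
have QE : (1%:M - P) *m E^t* = 0.
  by have /orthomx1P := proj_ortho_compl_sub E 1%:M; rewrite mul1mx.
have AEt : A *m E^t* = mu^* *: E^t*.
  have /(congr1 (fun X => X^t*)) : E *m A = mu *: E by exact/eigenspaceP.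
  have /is_hermitianmxP := Aherm; rewrite expr0 scale1r => {2}->.
  by rewrite trmx_mul map_mxM linearZ /= map_mxZ.
have : (1%:M - P) *m A *m P = 0.
  by apply/proj_ortho_0/orthomx1P; rewrite -mulmxA AEt -scalemxAr QE scaler0.
rewrite mulmxBl mul1mx mulmxBl PA -scalemxAl proj_ortho_proj.
by move=> /eqP; rewrite subr_eq0 => /eqP.
Qed.

End SpectralCalculus.

(** * The unitary group of a Hermitian matrix *)

Section UnitaryGroup.
Variables (R : realType) (n : nat) (A : 'M[R[i]]_n) (t : R).
Hypothesis Aherm : A \is hermsymmx.

Definition cis (x : R) : R[i] := cos x +i* sin x.

Let P := spectralmx A.
Let d := spectral_diag A.
(** The eigenvalues [d] are real because [A] is Hermitian, so the real part only changes their
    type. *)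
Let f : 'rV[R[i]]_n := \row_j cis (t * complex.Re (d 0 j)).
Let U := expmx (('i%C * t%:C) *: A).

Let Punit : P \in unitmx := spectral_unit A.

Let AE : A = invmx P *m diag_mx d *m P.
Proof. exact/orthomx_spectralP/hermitian_normalmx. Qed.

Lemma expmx_hermE : U = invmx P *m diag_mx f *m P.
Proof.
rewrite /U [in LHS]AE scalemxAl scalemxAr -linearZ /=.
apply: expmx_conj_diag => // j; rewrite !mxE.
have /mxOverP/(_ 0 j) := hermitian_spectral_diag_real Aherm.
move=> /complex_realP[x dx]; rewrite -/d in dx.
rewrite dx /= -mulrA -rmorphM /=; exact: cvg_expi.
Qed.

Lemma expmx_herm_unitary : U \is unitarymx.
Proof.
have PU : P \is unitarymx := spectral_unitarymx A.
rewrite expmx_hermE invmx_unitary //.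
rewrite !mul_unitarymx ?trmxC_unitary //.
apply/unitarymxP; rewrite tr_diag_mx map_diag_mx mulmx_diag.
apply/matrixP => i j; rewrite !mxE -normCK normc_def /= cos2Dsin2 sqrtr1.
by rewrite expr1n.
Qed.

Lemma mulmx_expmx_herm m (M : 'M[R[i]]_(m, n)) (mu : R[i]) :
  M *m A = mu *: M -> M *m U = cis (t * complex.Re mu) *: M.
Proof.
move=> MA; rewrite expmx_hermE !mulmxA.
(* [M *m invmx P] intertwines the constant diagonal mu with [d], hence also the corresponding values
   of [cis]. *)
have MPd : diag_mx (const_mx mu) *m (M *m invmx P) = M *m invmx P *m diag_mx d.
  rewrite diag_const_mx mul_scalar_mx scalemxAl -MA [in LHS]AE !mulmxA.
  by rewrite mulmxK.
rewrite -(diag_mx_intertwine (f' := const_mx (cis (t * complex.Re mu))) _ MPd).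
  by rewrite diag_const_mx mul_scalar_mx -scalemxAl mulmxKV.
by move=> i j; rewrite !mxE => ->.
Qed.

Lemma tr_expmx_herm : A^T = A -> U^T = U.
Proof.
move=> AT; have PA : P *m A = diag_mx d *m P.
  by rewrite [in LHS]AE !mulmxA mulmxV // mul1mx.
(* [P] is only unitary, so its transpose need not be its inverse. Symmetry of [A] makes [P *m P^T]
   commute with [diag_mx d], hence with [diag_mx f], which repairs this. *)
have PPd : diag_mx d *m (P *m P^T) = P *m P^T *m diag_mx d.
  rewrite mulmxA -PA -!mulmxA; congr (_ *m _).
  by rewrite -[in LHS]AT -trmx_mul PA trmx_mul tr_diag_mx.
have PPf : diag_mx f *m (P *m P^T) = P *m P^T *m diag_mx f.
  by apply: diag_mx_intertwine PPd => i j; rewrite !mxE => ->.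
rewrite expmx_hermE !trmx_mul tr_diag_mx trmx_inv.
have PTu : P^T \in unitmx by rewrite unitmx_tr.
apply: (can_inj (mulKmx Punit)).
by rewrite !mulmxA -PPf !mulmxA mulmxK // mulmxV // mul1mx.
Qed.

End UnitaryGroup.

(** * Symmetry and kernel of the Laplacian *)

Section Laplacian.
Variables (R : realType) (n : nat) (X : simple_graph n).

Lemma tr_laplacian : (laplacian R X)^T = laplacian R X.
Proof.
rewrite /laplacian linearB /= tr_diag_mx; congr (_ - _).
by apply/matrixP => i j; rewrite !mxE adj_sym.
Qed.

Lemma laplacian_herm : laplacian R X \is hermsymmx.
Proof.
apply/is_hermitianmxP; rewrite expr0 scale1r tr_laplacian.
by apply/matrixP => i j; rewrite !mxE rmorphB /= rmorphMn /= !conjC_nat.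
Qed.

Lemma mul_ones_laplacian : const_mx 1 *m laplacian R X = 0 :> 'rV_n.
Proof.
apply/rowP => j; rewrite mulmxBr mul_mx_diag !mxE mul1r.
apply/eqP; rewrite subr_eq0; apply/eqP.
under [RHS]eq_bigr do rewrite !mxE mul1r adj_sym.
by rewrite -natr_sum /degree -sum1dep_card big_mkcond.
Qed.

End Laplacian.

Theorem theorem7p2 (R : realType) (n : nat) (X : simple_graph n) (a b : 'I_n) :
  proper_laplacian_fractional_revival R X a b ->
  laplacian_strongly_cospectral R X a b.
Proof.
move=> [tau [alpha [beta [[ba Ua] beta0]]]] mu _ F.
have Lherm := laplacian_herm R X.
set L := laplacian R X in F Lherm *.
rewrite /vertex_vec in Ua *.
set ea := delta_mx a 0 in Ua *; set eb := delta_mx b 0 in Ua *.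
pose U := transition_mx X tau; rewrite -/U in Ua.
have UT : U^T = U by apply: tr_expmx_herm => //; exact: tr_laplacian.
have Uunit : U \is unitarymx by exact: expmx_herm_unitary.
have oneU : const_mx 1 *m U = const_mx 1 :> 'rV_n.
  rewrite (mulmx_expmx_herm (mu := 0) tau Lherm).
    by rewrite mulr0 /cis cos0 sin0 scale1r.
  by rewrite mul_ones_laplacian scale0r.
(* Transposing undoes the transposition in [eigenproj] and leaves the commuted relation for the row
   projection. *)
have FL : F *m L = mu *: F.
  apply: trmx_inj; rewrite trmx_mul tr_laplacian linearZ /= trmxK tr_laplacian.
  exact: proj_ortho_eigenspaceC.
have {}FL := mulmx_expmx_herm tau Lherm FL.
rewrite -/(transition_mx X tau) -/U in FL.
set lam := cis _ in FL.
have one_delta (i : 'I_n) : const_mx 1 *m delta_mx i 0 = 1%:M :> 'M[R[i]]_1.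
  by rewrite -colE; apply/matrixP => ? ?; rewrite !mxE !ord1.
have conj_delta (i : 'I_n) : map_mx Num.Def.conjC (delta_mx i 0) = delta_mx i 0 :> 'cV[R[i]]_n.
  by rewrite map_delta_mx.
have sum1 (x y : R[i]) (i : 'I_n) :
    U *m delta_mx i 0 = x *: ea + y *: eb -> x + y = 1.
  move=> /(congr1 (mulmx (const_mx 1 : 'rV_n))).
  rewrite mulmxA oneU mulmxDr -!scalemxAr !one_delta -scalerDl.
  by move=> /matrixP/(_ 0 0); rewrite !mxE mulr1.
(* By symmetry the adjoint of U is its entrywise conjugate, so conjugating [Ua] gives the adjoint's
   action on [ea]. Applying U yields [ea] as a combination of U [ea] and U [eb], which is solved for
   U [eb] by dividing by the conjugate of beta. *)
have [x [y Ub]] : exists x y, U *m eb = x *: ea + y *: eb.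
  have Ca : U^t* *m ea = alpha^* *: ea + beta^* *: eb.
    rewrite UT -[ea in LHS]conj_delta -map_mxM Ua map_mxD !map_mxZ.
    by rewrite !conj_delta.
  have := congr1 (mulmx U) Ca.
  rewrite mulmxA (unitarymxP Uunit) mul1mx mulmxDr -!scalemxAr Ua => eaE.
  exists (beta^*^-1 * (1 - alpha^* * alpha)), (- beta^*^-1 * (alpha^* * beta)).
  apply: (scalerI (a := beta^*)).
    by rewrite conjC_eq0; exact/eqP.
  have betaC0 : beta^* != 0 by rewrite conjC_eq0; exact/eqP.
  rewrite scalerDr !scalerA !(mulNr, mulrN) !mulVKf //.
  move/eqP: eaE; rewrite addrC -subr_eq => /eqP <-.
  by rewrite scalerDr !scalerA scalerBl scale1r scaleNr opprD addrA.
(* Here x and beta are the entries of U at (a, b) and (b, a). *)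
have xE : x = beta.
  have ab : (a == b) = false by apply/eqP => /esym.
  have := congr1 (fun M : 'cV_n => M b 0) Ua.
  rewrite -colE !mxE !eqxx [b == a]eq_sym ab.
  have := congr1 (fun M : 'cV_n => M a 0) Ub.
  rewrite -colE !mxE !eqxx ab.
  rewrite /= !mulr1 !mulr0 addr0 add0r => <- <-.
  by rewrite -[in LHS]UT mxE.
(* Both alpha + beta and x + y equal 1. *)
have yE : y = alpha.
  have := sum1 _ _ _ Ua; rewrite -(sum1 _ _ _ Ub) xE addrC.
  by move=> /addrI.
rewrite {}xE {}yE in Ub.
have FUa : lam *: (F *m ea) = alpha *: (F *m ea) + beta *: (F *m eb).
  by rewrite scalemxAl -FL -mulmxA Ua mulmxDr !scalemxAr.
have FUb : lam *: (F *m eb) = beta *: (F *m ea) + alpha *: (F *m eb).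
  by rewrite scalemxAl -FL -mulmxA Ub mulmxDr !scalemxAr.
move: FUa FUb; set u := F *m ea; set v := F *m eb => FUa FUb.
have {}FUa : (lam - alpha) *: u = beta *: v by rewrite scalerBl FUa addrC addKr.
have {}FUb : (lam - alpha) *: v = beta *: u by rewrite scalerBl FUb addrK.
move/eqP: beta0 => beta0.
(* If u = 0, then beta v = 0, so v = 0 too. *)
have [u0|u0] := eqVneq u 0.
  by left; apply: (scalerI beta0); rewrite -FUa u0 !scaler0.
have : ((lam - alpha) ^+ 2 - beta ^+ 2) *: u == 0.
  by rewrite scalerBl !expr2 -!scalerA FUa -FUb !scalerA mulrC subrr.
rewrite scaler_eq0 (negPf u0) orbF subr_eq0.
rewrite eqf_sqr => /orP[] /eqP lamE; [left|right]; apply: (scalerI beta0).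
  by rewrite -FUa lamE.
by rewrite scalerN -FUa lamE scaleNr opprK.
Qed.
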